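(* Let $d=2\nu+1>1$ be an odd integer and let $p(x,y)=\sum_{i=0}^{d}\binom{d}{i}c_i\,x^{i}y^{d-i}$ be a real binary form of degree $d$, with $(c_0,\dots,c_d)\in\mathbb{R}^{d+1}\setminus\{\vec 0\}$. Then there exist an open and dense semialgebraic set $\mathcal{G}\subset\mathbb{R}^{\nu}$ and real rational functions $R_1,R_2$ of $(s_1,\dots,s_\nu)$, defined on $\mathcal{G}$, such that for every $(s_1,\dots,s_\nu)\in\mathcal{G}$ the form $p$ has a real Waring decomposition $$p(x,y)=\sum_{j=1}^{\nu}\lambda_{2j-1}(x+s_j y)^d+\sum_{j=1}^{\nu}\lambda_{2j}(x-s_j y)^d+\lambda_d\,(R_1x+R_2y)^d$$ for some real numbers $\lambda_1,\dots,\lambda_d$, where $R_1,R_2$ are evaluated at $(s_1,\dots,s_\nu)$ and the $d$ linear forms $x\pm s_jy$ $(1\le j\le\nu)$ and $R_1x+R_2y$ are pairwise non-proportional.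
   Context: A Waring decomposition over $\mathbb{R}$ of a real binary form $p$ of degree $d$ is an expression $p=\sum_{i=1}^r\lambda_i\ell_i^d$ with $\lambda_i\in\mathbb{R}$ and $\ell_i=\alpha_ix+\beta_iy$ real linear forms that are pairwise non-proportional. *)

(* Defs.v *)
From HB Require Import structures.
From mathcomp Require Import all_boot all_order all_algebra.
From mathcomp Require Import all_classical all_reals all_analysis.
(* Its notations clash with those of mathcomp-analysis. *)
From mathcomp Require Import (canonicals, coercions) mpoly.

Set Implicit Arguments.
Unset Strict Implicit.
Unset Printing Implicit Defensive.

Import Order.TTheory GRing.Theory Num.Theory.
Import numFieldNormedType.Exports.

#[global] Open Scope classical_set_scope.
#[global] Open Scope ring_scope.

Section Polynomials.
Variables (R : realType) (n : nat).
Implicit Types (P : mpoly.mpoly n R) (v : 'rV[R]_n) (A : set 'rV[R]_n).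

Definition peval P v : R := mpoly.meval (v 0) P.

(* A pair of lists (E, I) stands for the system P = 0 (P in E), 0 < Q (Q in I);
   a semialgebraic set is a finite union of solution sets of such systems. *)
Definition solves (S : seq (mpoly.mpoly n R) * seq (mpoly.mpoly n R)) v : bool :=
  all (fun P => peval P v == 0) S.1 && all (fun Q => 0 < peval Q v) S.2.

Definition semialgebraic A : Prop :=
  exists Ss : seq (seq (mpoly.mpoly n R) * seq (mpoly.mpoly n R)),
    A = [set v | has (fun S => solves S v) Ss].

(* Only the values of f on A matter. *)
Definition rational_on A (f : 'rV[R]_n -> R) : Prop :=
  exists P Q : mpoly.mpoly n R,
    forall v, A v -> peval Q v != 0 /\ f v = peval P v / peval Q v.

End Polynomials.

Section BinaryForms.
Variable R : realType.

Local Notation bpoly := (mpoly.mpoly 2 R).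

Definition x_ : bpoly := mpoly.mpolyX R (mpoly.mnm1 (ord0 : 'I_2)).
Definition y_ : bpoly := mpoly.mpolyX R (mpoly.mnm1 (ord_max : 'I_2)).

Definition binary_form (d : nat) (c : 'rV[R]_d.+1) : bpoly :=
  \sum_(i < d.+1) ('C(d, i)%:R * c 0 i) *: (x_ ^+ i * y_ ^+ (d - i)).

Definition linear_form (l : bpoly) : Prop :=
  exists a b : R, l = a *: x_ + b *: y_.

(* Linear dependence; in particular 0 is proportional to every form. *)
Definition proportional (l m : bpoly) : Prop :=
  exists a b : R, (a != 0 \/ b != 0) /\ a *: l = b *: m.

(* The pairs in [ts] are the (lambda_i, l_i) of the decomposition. *)
Definition waring_decomposition (d : nat) (p : bpoly) (ts : seq (R * bpoly)) : Prop :=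
  [/\ p = \sum_(t <- ts) t.1 *: t.2 ^+ d,
      forall t, t \in ts -> linear_form t.2
    & forall i j : nat, (i < j < size ts)%N ->
        ~ proportional (nth (0, 0) ts i).2 (nth (0, 0) ts j).2].

End BinaryForms.

Arguments x_ {R}.
Arguments y_ {R}.

(* Main.v *)
Require Import Defs.
From mathcomp Require Import all_boot all_order all_algebra.
From mathcomp Require Import all_classical all_reals all_analysis.
From mathcomp Require Import (canonicals, coercions) mpoly.
From mathcomp Require Import ring zify.
Import Order.TTheory GRing.Theory Num.Theory.
Import numFieldNormedType.Exports.

(** Write [p = \sum_k 'C(d, k) e_k x^(d - k) y^k] and let [D_s] be the
    differential operator [\prod_j (dy ^ 2 - s_j ^ 2 dx ^ 2)] of order
    [2 nu = d - 1].  It kills every power [(x + s_j y)^d] and [(x - s_j y)^d], and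
    it sends [(a x + b y)^d] to [d! \prod_j (b ^ 2 - s_j ^ 2 a ^ 2) (a x + b y)].
    Applied to [p] it leaves a linear form, [d!] times some [A x + B y], where [A]
    and [B] are polynomials in [s].  So, as soon as
    [\prod_j (B ^ 2 - s_j ^ 2 A ^ 2)] is nonzero, subtracting from [p] a suitable
    multiple of [(A x + B y)^d] gives a form that [D_s] kills.  By apolarity such
    a form is a combination of the powers of the [x + s_j y] and [x - s_j y],
    provided that these [2 nu] forms are pairwise non-proportional.  So one can
    take [R1 = A] and [R2 = B], which are polynomials.

    In coefficients, [A] and [B] are [even_contraction] and [odd_contraction].
    Apolarity splits according to the parity of [k] into two recurrences with
    nodes [s_j ^ 2], each solved by a Vandermonde system ([apolar_power_sums]);
    the subtraction is [symmetric_power_sums_with_extra].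

    The set of good [s] is the nonvanishing locus of one polynomial, so it is open
    and semialgebraic.  A nonvanishing locus is dense once it is nonempty
    ([dense_nonvanishing]), and dense open sets intersect in dense sets, so each
    factor of that polynomial needs only one nonzero of its own.  For
    [B ^ 2 - s_j ^ 2 A ^ 2] it is found on the diagonal [s = (z, ..., z)]
    ([contractions_nondegenerate]), and this is where [p != 0] enters. *)

Set Implicit Arguments.
Unset Strict Implicit.
Unset Printing Implicit Defensive.

(** * Nonvanishing loci of polynomials *)

Lemma exists_small_nonroot (R : realFieldType) (p : {poly R}) (e : R) :
  p != 0 -> 0 < e -> exists t, [/\ 0 < t, t < e & p.[t] != 0].
Proof.
move=> p0 e0; pose rs := [seq e / k.+2%:R | k <- iota 0 (size p)].
have [/hasP[t /mapP[k _ ->] nr]|/hasPn allr] := boolP (has (fun t => p.[t] != 0) rs).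
  exists (e / k.+2%:R); split=> //; first by rewrite divr_gt0.
  by rewrite ltr_pdivrMr // ltr_pMr // ltr1n.
have : (size rs < size p)%N.
  apply: max_poly_roots => //; first by apply/allP => t /allr; rewrite negbK.
  rewrite map_inj_uniq ?iota_uniq // => i j.
  by move/(mulfI (lt0r_neq0 e0))/invr_inj/eqP; rewrite eqr_nat => /eqP[].
by rewrite size_map size_iota ltnn.
Qed.

Section Nonvanishing.
Local Open Scope classical_set_scope.
Local Open Scope ring_scope.
Variables (R : realType) (n : nat).
Implicit Types (P : mpoly.mpoly n R) (v w : 'rV[R]_n).

Lemma peval_continuous P : continuous (peval P).
Proof.
rewrite /peval; under eq_fun do rewrite mpoly.mevalE.
apply: continuous_big => [|m _].
  exact: add_continuous.
have cX : continuous (fun v : 'rV[R]_n => \prod_i v 0 i ^+ m i).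
  apply: continuous_big => [|i _].
    exact: mul_continuous.
  move=> v; apply: (@continuous_comp _ _ _ (fun v : 'rV[R]_n => v 0 i) (fun x => x ^+ m i)).
    exact: coord_continuous.
  exact: exprn_continuous.
by move=> v; exact: (cvgM (cvg_cst _) (cX v)).
Qed.

Lemma peval_line P v w :
  exists p : {poly R}, forall t, p.[t] = peval P (v + t *: w).
Proof.
exists (\sum_(m <- mpoly.msupp P) (mpoly.mcoeff m P)%:P *
          \prod_i ((v 0 i)%:P + (w 0 i)%:P * 'X) ^+ m i) => t.
rewrite /peval mpoly.mevalE horner_sum; apply: eq_bigr => m _.
rewrite hornerM hornerC horner_prod; congr (_ * _); apply: eq_bigr => i _.
by rewrite !hornerE !mxE mulrC.
Qed.

Lemma open_nonvanishing P : open [set v | peval P v != 0].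
Proof.
apply: (@open_comp _ _ (peval P) [set x | x != 0]); last exact: open_neq.
by move=> v _; exact: peval_continuous.
Qed.

(** Along the line from a given point to a nonzero of [P], the polynomial
    vanishes only finitely often, so it has nonzeros close to that point. *)
Lemma dense_nonvanishing P w :
  peval P w != 0 -> dense [set v | peval P v != 0].
Proof.
move=> Pw O [v Ov] oO.
have [p pE] := peval_line P v (w - v).
have p0 : p != 0.
  apply: contra_neq Pw => p0; have := pE 1.
  by rewrite p0 horner0 scale1r addrC subrK.
have lc : {for 0, continuous (fun t : R => v + t *: (w - v))}.
  by apply: cvgD; [exact: cvg_cst|apply: cvgZr_tmp; exact: cvg_id].
have : nbhs 0 ((fun t : R => v + t *: (w - v)) @^-1` O).
  by apply: lc; rewrite scale0r addr0; exact: open_nbhs_nbhs.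
move=> /nbhs_ballP[e /= e0 eO].
have [t [t0 te pt]] := exists_small_nonroot p0 e0.
exists (v + t *: (w - v)); split; last by rewrite /= -pE.
by apply: eO; rewrite /ball /= sub0r normrN gtr0_norm.
Qed.

Lemma dense_nonvanishingM P Q :
  dense [set v | peval P v != 0] -> dense [set v | peval Q v != 0] ->
  dense [set v | peval (P * Q) v != 0].
Proof.
move=> dP dQ; rewrite [X in dense X](_ : _ =
  [set v | peval P v != 0] `&` [set v | peval Q v != 0]).
  by apply: denseI => //; exact: open_nonvanishing.
by apply/seteqP; split=> v; rewrite /= /peval mpoly.mevalM mulf_eq0 negb_or => /andP.
Qed.

Lemma peval_prod (I : Type) (r : seq I) (A : pred I) (F : I -> mpoly.mpoly n R) v :
  peval (\prod_(i <- r | A i) F i) v = \prod_(i <- r | A i) peval (F i) v.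
Proof. exact: rmorph_prod. Qed.

Lemma dense_nonvanishing_prod (I : Type) (r : seq I) (A : pred I)
    (F : I -> mpoly.mpoly n R) :
  (forall i, A i -> exists w, peval (F i) w != 0) ->
  dense [set v | peval (\prod_(i <- r | A i) F i) v != 0].
Proof.
move=> F0; apply: (big_rec (fun P => dense [set v | peval P v != 0])) => [|i P Ai dP].
  by apply: (@dense_nonvanishing _ (0 : 'rV[R]_n)); rewrite /peval mpoly.meval1 oner_eq0.
have [w Fw] := F0 i Ai; apply: dense_nonvanishingM => //.
exact: dense_nonvanishing Fw.
Qed.

Lemma semialgebraic_nonvanishing P : semialgebraic [set v | peval P v != 0].
Proof.
(* over an ordered field, a nonzero value is one of positive square *)
exists [:: ([::], [:: P ^+ 2])]; apply/seteqP.
have sq v : peval (P ^+ 2) v = peval P v ^+ 2 by rewrite /peval rmorphXn.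
by split=> v /=; rewrite /solves /= sq !andbT !orbF exprn_even_gt0.
Qed.

End Nonvanishing.

(** * Apolarity and sums of powers *)

Section Apolarity.
Variable F : fieldType.

Definition node_poly (n : nat) (u : 'I_n -> F) : {poly F} :=
  \prod_(j < n) ('X - (u j)%:P).

Lemma size_node_poly n (u : 'I_n -> F) : size (node_poly u) = n.+1.
Proof. by rewrite /node_poly -big_enum size_prod_XsubC size_enum_ord. Qed.

Lemma coef_node_poly_max n (u : 'I_n -> F) : (node_poly u)`_n = 1.
Proof.
have /monicP : node_poly u \is monic by apply: monic_prod_XsubC.
by rewrite lead_coefE size_node_poly.
Qed.

Lemma horner_node_poly n (u : 'I_n -> F) x :
  \sum_(m < n.+1) (node_poly u)`_m * x ^+ m = \prod_(j < n) (x - u j).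
Proof.
rewrite -[in LHS](size_node_poly u) -horner_coef horner_prod.
by apply: eq_bigr => j _; rewrite !hornerE.
Qed.

Lemma homogenized_node_poly n (u : 'I_n -> F) x y :
  \sum_(m < n.+1) (node_poly u)`_m * (x ^+ (n - m) * y ^+ m)
    = \prod_(j < n) (y - u j * x).
Proof.
have [->|x0] := eqVneq x 0.
  rewrite big_ord_recr /= big1 ?add0r => [|m _].
    rewrite coef_node_poly_max subnn expr0 !mul1r.
    by under eq_bigr do rewrite mulr0 subr0; rewrite prodr_const card_ord.
  by rewrite expr0n subn_eq0 leqNgt ltn_ord /= mul0r mulr0.
transitivity (x ^+ n * \sum_(m < n.+1) (node_poly u)`_m * (y / x) ^+ m).
  rewrite mulr_sumr; apply: eq_bigr => m _.
  rewrite expr_div_n expfB_cond ?(negPf x0) //; last by rewrite add0n -ltnS.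
  by ring.
rewrite horner_node_poly -[X in x ^+ X](card_ord n) -prodr_const -big_split /=.
by apply: eq_bigr => j _; field.
Qed.

(** The Vandermonde system of the nodes has a unique solution matching the first
    [n] terms, and apolarity to the polynomial with these nodes as roots is the
    linear recurrence through which the next term is then matched as well. *)
Lemma apolar_power_sums n (u : 'I_n -> F) (f : nat -> F) :
  injective u -> \sum_(m < n.+1) (node_poly u)`_m * f m = 0 ->
  exists a : 'I_n -> F,
    forall m, (m <= n)%N -> f m = \sum_j a j * u j ^+ m.
Proof.
move=> u_inj apo; pose V := Vandermonde n (\row_j u j).
have V_unit : V \in unitmx.
  rewrite unitmxE det_Vandermonde unitfE; apply/prodf_neq0 => i _.
  apply/prodf_neq0 => j ij; rewrite !mxE subr_eq0 (inj_eq u_inj).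
  by apply: contraTneq ij => ->; rewrite ltnn.
pose a := invmx V *m (\col_(m < n) f m).
have aE m : (m < n)%N -> f m = \sum_j a j 0 * u j ^+ m.
  move=> mn; have := mulKVmx V_unit (\col_(m < n) f m).
  move/matrixP/(_ (Ordinal mn) 0); rewrite mxE [RHS]mxE /= => <-.
  by apply: eq_bigr => j _; rewrite !mxE mulrC.
exists (fun j => a j 0) => m; rewrite leq_eqVlt => /predU1P[->{m}|]; last exact: aE.
move: apo; rewrite big_ord_recr /= coef_node_poly_max mul1r => /eqP.
rewrite addrC addr_eq0 => /eqP ->.
have root0 j : \sum_(m < n.+1) (node_poly u)`_m * u j ^+ m = 0.
  by rewrite horner_node_poly (bigD1 j) //= subrr mul0r.
transitivity (- \sum_(m < n) (node_poly u)`_m * \sum_j a j 0 * u j ^+ m).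
  by congr (- _); apply: eq_bigr => m _; rewrite -aE.
under [X in - X = _]eq_bigr do rewrite mulr_sumr.
rewrite exchange_big /= -sumrN; apply: eq_bigr => j _.
have := root0 j; rewrite big_ord_recr /= coef_node_poly_max mul1r => /eqP.
rewrite addrC addr_eq0 => /eqP ->; rewrite mulrN mulr_sumr; congr (- _).
by apply: eq_bigr => m _; rewrite mulrCA.
Qed.

Lemma coef_XsubC_exp n (x : F) k : (k <= n)%N ->
  (('X - x%:P) ^+ n)`_(n - k) = (-1) ^+ k * x ^+ k *+ 'C(n, k).
Proof.
move=> kn; have kn' : (k < n.+1)%N by [].
rewrite exprBn coef_sum (bigD1 (Ordinal kn')) //= big1 => [|i].
  rewrite addr0 coefMn -polyC1 -polyCN -!polyC_exp.
  by rewrite mulrAC -polyCM coefCM coefXn eqxx mulr1.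
rewrite -val_eqE /= => ik; rewrite coefMn -polyC1 -polyCN -!polyC_exp.
rewrite mulrAC -polyCM coefCM coefXn.
case: eqP => [|_]; last by rewrite mulr0 mul0rn.
by have := ltn_ord i; move/eqP: ik; lia.
Qed.

End Apolarity.

Section SymmetricNodes.
Variable F : numFieldType.

(** The coefficient of [x] in the linear form that the operator
    [\prod_j (dy ^ 2 - s j ^ 2 dx ^ 2)] makes, up to a factorial, of the form with
    normalized coefficients [e k] at [x ^ (2 n + 1 - k) y ^ k]; the coefficient of
    [y] is [odd_contraction]. *)
Definition even_contraction n (s : 'I_n -> F) (e : nat -> F) : F :=
  \sum_(m < n.+1) (node_poly (fun j => s j ^+ 2))`_m * e m.*2.

Definition odd_contraction n (s : 'I_n -> F) (e : nat -> F) : F :=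
  even_contraction s (fun k => e k.+1).

(** The even and the odd terms are separately apolar sequences with nodes
    [s j ^+ 2]; as weights the even terms determine [p j + m j] and the odd ones
    [(p j - m j) * s j]. *)
Lemma symmetric_power_sums n (s : 'I_n -> F) (e : nat -> F) :
  (forall j, s j != 0) -> injective (fun j => s j ^+ 2) ->
  even_contraction s e = 0 -> odd_contraction s e = 0 ->
  exists p m : 'I_n -> F, forall k, (k <= n.*2.+1)%N ->
    e k = \sum_j p j * s j ^+ k + \sum_j m j * (- s j) ^+ k.
Proof.
move=> s0 s_inj ev0 od0.
have [a aE] := apolar_power_sums (f := fun m => e m.*2) s_inj ev0.
have [b bE] := apolar_power_sums (f := fun m => e m.*2.+1) s_inj od0.
exists (fun j => (a j + b j / s j) / 2), (fun j => (a j - b j / s j) / 2) => k kn.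
rewrite -big_split /=; have [h [hn hk]] : exists h, (h <= n)%N /\ k = (odd k + h.*2)%N.
  by exists k./2; split; [lia|rewrite odd_double_half].
rewrite hk; case: (odd k); rewrite ?add1n ?add0n.
  rewrite bE //; apply: eq_bigr => j _.
  by rewrite !(exprS _ h.*2) -mul2n !exprM sqrrN; field.
rewrite aE //; apply: eq_bigr => j _.
by rewrite -mul2n !exprM sqrrN; field.
Qed.

(** The contractions of the sequence of the form [(a x + b y) ^ (2 n + 1)] are
    [a] and [b] times [\prod_j (b ^ 2 - s j ^ 2 * a ^ 2)].  If [a] and [b] are
    themselves the contractions of [e], dividing by that product therefore gives
    a sequence with the same contractions as [e], and the difference is a
    combination of symmetric powers. *)
Lemma symmetric_power_sums_with_extra n (s : 'I_n -> F) (e : nat -> F) :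
  let A := even_contraction s e in let B := odd_contraction s e in
  (forall j, s j != 0) -> injective (fun j => s j ^+ 2) ->
  (forall j, B ^+ 2 - s j ^+ 2 * A ^+ 2 != 0) ->
  exists (p m : 'I_n -> F) (l : F), forall k, (k <= n.*2.+1)%N ->
    e k = \sum_j p j * s j ^+ k + \sum_j m j * (- s j) ^+ k
          + l * (A ^+ (n.*2.+1 - k) * B ^+ k).
Proof.
move=> A B s0 s_inj D0; pose D := \prod_j (B ^+ 2 - s j ^+ 2 * A ^+ 2).
have {}D0 : D != 0 by apply/prodf_neq0 => j _.
pose f k := e k - D^-1 * (A ^+ (n.*2.+1 - k) * B ^+ k).
have contrD : \sum_(m < n.+1) (node_poly (fun j => s j ^+ 2))`_m *
    ((A ^+ 2) ^+ (n - m) * (B ^+ 2) ^+ m) = D.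
  exact: homogenized_node_poly.
have fA : even_contraction s f = 0.
  rewrite /even_contraction /f; under eq_bigr do rewrite mulrBr.
  rewrite big_split /= sumrN -/(even_contraction s e) -/A; apply/eqP.
  rewrite subr_eq0; apply/eqP; rewrite -[LHS](mulKf D0) -{2}contrD mulr_suml mulr_sumr.
  apply: eq_bigr => m _; have -> : (n.*2.+1 - m.*2 = (2 * (n - m)).+1)%N.
    by have := ltn_ord m; lia.
  by rewrite (exprS _ (2 * (n - m))) -mul2n !exprM; ring.
have fB : odd_contraction s f = 0.
  rewrite /odd_contraction /even_contraction /f; under eq_bigr do rewrite mulrBr.
  rewrite big_split /= sumrN -/(even_contraction s (fun k => e k.+1)).
  rewrite -/(odd_contraction s e) -/B; apply/eqP.
  rewrite subr_eq0; apply/eqP; rewrite -[LHS](mulKf D0) -{2}contrD mulr_suml mulr_sumr.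
  apply: eq_bigr => m _; have -> : (n.*2.+1 - m.*2.+1 = 2 * (n - m))%N.
    by have := ltn_ord m; lia.
  by rewrite (exprS _ m.*2) -mul2n !exprM; ring.
have [p [m pmE]] := symmetric_power_sums s0 s_inj fA fB.
by exists p, m, D^-1%R => k kn; rewrite -pmE // subrK.
Qed.

(** When all the [s j] are equal to [z], the contractions are [a.[z ^+ 2]] and
    [b.[z ^+ 2]] for polynomials [a] and [b] whose coefficients are those of [e]
    up to nonzero factors, and [b ^+ 2] cannot equal ['X * a ^+ 2] because their
    degrees have opposite parities. *)
Lemma contractions_nondegenerate n (e : nat -> F) :
  (exists2 k, (k <= n.*2.+1)%N & e k != 0) ->
  exists2 p : {poly F}, p != 0 &
    forall z, p.[z ^+ 2] =
      odd_contraction (fun _ : 'I_n => z) e ^+ 2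
      - z ^+ 2 * even_contraction (fun _ : 'I_n => z) e ^+ 2.
Proof.
(* the coefficient of degree [i] in [z ^ 2] comes from the coefficient of degree
   [n - i] of the node polynomial, which is here [('X - z ^ 2) ^ n] *)
pose co (f : nat -> F) i := f (n - i).*2 * ((-1) ^+ i *+ 'C(n, i)).
pose a f := \poly_(i < n.+1) co f i.
have aE f z : (a f).[z ^+ 2] = even_contraction (fun _ : 'I_n => z) f.
  rewrite horner_poly /even_contraction [RHS](reindex_inj rev_ord_inj) /=.
  apply: eq_bigr => i _; rewrite subSS /node_poly prodr_const card_ord.
  have iN : (i <= n)%N by rewrite -ltnS.
  by rewrite coef_XsubC_exp // [RHS]mulrC -mulrA mulrnAl.
have a_neq0 f h : (h <= n)%N -> f h.*2 != 0 -> a f != 0.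
  move=> hn; apply: contra_neq => /polyP/(_ (n - h)%N).
  rewrite coef_poly ltnS leq_subr coef0 /co subKn // => /eqP.
  by rewrite mulf_eq0 mulrn_eq0 signr_eq0 orbF eqn0Ngt bin_gt0 leq_subr orbF => /eqP.
case=> k kn ek; pose b := a (fun k => e k.+1).
have [h [hn hk]] : exists h, (h <= n)%N /\ k = (odd k + h.*2)%N.
  by exists k./2; split; [lia|rewrite odd_double_half].
exists (b ^+ 2 - 'X * a e ^+ 2) => [|z]; last first.
  by rewrite !hornerE /= !aE.
rewrite subr_eq0; apply/eqP => ab.
have [ae0|ae0] := eqVneq (a e) 0; have [b0|b0] := eqVneq b 0.
- move: ek; rewrite hk; case: (odd k); rewrite ?add1n ?add0n => ek.
    by have := a_neq0 (fun k => e k.+1) h hn ek; rewrite -/b b0 eqxx.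
  by have := a_neq0 e h hn ek; rewrite ae0 eqxx.
- by move/eqP: ab; rewrite ae0 expr0n mulr0 sqrf_eq0 (negPf b0).
- by move/esym/eqP: ab; rewrite b0 expr0n mulf_eq0 polyX_eq0 sqrf_eq0 (negPf ae0).
have := congr1 (fun p : {poly F} => odd (size p)) ab.
rewrite /= mulrC size_mulX ?expf_neq0 // /= !expr2 !size_mul //.
move: b0 ae0; rewrite -!size_poly_gt0; case: (size b) (size (a e)) => // p [|q] // _ _.
by rewrite !addSn /= !addnS !addnn /= !odd_double.
Qed.

End SymmetricNodes.

(** * Binary forms *)

Section Forms.
Variable R : realType.
Local Open Scope ring_scope.

Lemma binary_form_sum d (I : Type) (r : seq I) (lam : I -> R) (v : I -> 'rV[R]_d.+1) :
  \sum_(i <- r) lam i *: binary_form (v i) = binary_form (\sum_(i <- r) lam i *: v i).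
Proof.
under eq_bigr do rewrite /binary_form scaler_sumr.
rewrite exchange_big; apply: eq_bigr => k _ /=.
under eq_bigr do rewrite scalerA.
rewrite -scaler_suml; congr (_ *: _); rewrite summxE mulr_sumr.
by apply: eq_bigr => i _; rewrite mxE mulrCA.
Qed.

Lemma binary_form_power d (a b : R) :
  (a *: x_ + b *: y_) ^+ d = binary_form (\row_(i < d.+1) (a ^+ i * b ^+ (d - i))).
Proof.
rewrite addrC exprDn; apply: eq_bigr => i _; rewrite !exprZn mxE.
by rewrite -scalerAl -scalerAr scalerA -scaler_nat scalerA mulrC
           [y_ ^+ _ * _]mulrC [b ^+ _ * _]mulrC mulrC.
Qed.

Lemma proportional_linear_forms (a b a' b' : R) :
  proportional (a *: x_ + b *: y_) (a' *: x_ + b' *: y_) -> a * b' = a' * b.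
Proof.
move=> [k [k' [kk' E]]].
have coef (g h u v : R) : mpoly.meval (fun i => if i == ord0 then u else v)
    (g *: x_ + h *: y_) = g * u + h * v.
  by rewrite mpoly.mevalD !mpoly.mevalZ !mpoly.mevalXU.
have Ea : k * a = k' * a'.
  have := congr1 (mpoly.meval (fun i => if i == ord0 then 1 else 0)) E.
  by rewrite !mpoly.mevalZ !coef !mulr1 !mulr0 !addr0.
have Eb : k * b = k' * b'.
  have := congr1 (mpoly.meval (fun i => if i == ord0 then 0 else 1)) E.
  by rewrite !mpoly.mevalZ !coef !mulr1 !mulr0 !add0r.
case: kk' => k0; apply: (mulfI k0).
  by rewrite mulrA Ea [RHS]mulrCA Eb; ring.
by rewrite [LHS]mulrCA -Eb [RHS]mulrA -Ea; ring.
Qed.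

Lemma waring_decomposition_of_coefs d (c : 'rV[R]_d.+1) (ts : seq (R * (R * R))) :
  (forall i, c 0 i = \sum_(t <- ts) t.1 * (t.2.1 ^+ i * t.2.2 ^+ (d - i))) ->
  pairwise (fun t t' => t.2.1 * t'.2.2 != t'.2.1 * t.2.2) ts ->
  waring_decomposition d (binary_form c)
    [seq (t.1, t.2.1 *: x_ + t.2.2 *: y_) | t <- ts].
Proof.
move=> cE npr; split.
- rewrite big_map; under eq_bigr do rewrite binary_form_power.
  rewrite binary_form_sum; congr binary_form; apply/rowP => i.
  by rewrite cE summxE; apply: eq_bigr => t _; rewrite !mxE.
- by move=> _ /mapP[t _ ->]; exists t.2.1, t.2.2.
move=> i j; rewrite size_map => /andP[ij jn].
have i_n := ltn_trans ij jn; pose t0 : R * (R * R) := (0, (0, 0)).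
rewrite !(nth_map t0) //= => /proportional_linear_forms.
by apply/eqP; move/(pairwiseP t0): npr; apply.
Qed.

End Forms.

Lemma interleave (T : Type) n (p m : 'I_n -> T) (l : T) :
  exists lam : nat -> T,
    [/\ forall j : 'I_n, lam (2 * j + 1)%N = p j,
        forall j : 'I_n, lam (2 * j + 2)%N = m j & lam (2 * n + 1)%N = l].
Proof.
exists (fun k => if insub (k.-1)./2 is Some j then (if odd k then p j else m j) else l).
split=> [j|j|].
- have -> : ((2 * j + 1).-1)./2 = j by lia.
  by rewrite valK ifT //; lia.
- have -> : ((2 * j + 2).-1)./2 = j by lia.
  by rewrite valK ifF //; lia.
by rewrite insubF //; lia.
Qed.

(** * Decompositions with generic symmetric nodes *)

Section GenericNodes.
Variables (R : realType) (n : nat) (e : nat -> R).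
Local Open Scope ring_scope.
Local Notation mp := (mpoly.mpoly n R).
Implicit Types (f : nat -> R) (v : 'rV[R]_n).

Definition var (j : 'I_n) : mp := mpoly.mpolyX R (mpoly.mnm1 j).

Definition contraction_poly f : mp :=
  \sum_(m < n.+1) f m.*2 *: (\prod_(j < n) ('X - (var j ^+ 2)%:P))`_m.

Lemma peval_contraction_poly f v :
  peval (contraction_poly f) v = even_contraction (v 0) f.
Proof.
rewrite /peval raddf_sum; apply: eq_bigr => m _ /=.
rewrite mpoly.mevalZ mulrC -coef_map map_prod_XsubC.
by under eq_bigr do rewrite rmorphXn /= mpoly.mevalXU.
Qed.

(** The first two products make the forms [x + s_j y] and [x - s_j y] pairwise
    non-proportional; the last one keeps the linear form obtained by contraction
    nonzero and away from all of them. *)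
Definition genericity_poly : mp :=
  (\prod_(j < n) var j) *
  (\prod_(jk : 'I_n * 'I_n | jk.1 != jk.2) (var jk.1 ^+ 2 - var jk.2 ^+ 2)) *
  \prod_(j < n) (contraction_poly (fun k => e k.+1) ^+ 2
                 - var j ^+ 2 * contraction_poly e ^+ 2).

Let A v := even_contraction (v 0) e.
Let B v := odd_contraction (v 0) e.

Lemma peval_extra j v :
  peval (contraction_poly (fun k => e k.+1) ^+ 2 - var j ^+ 2 * contraction_poly e ^+ 2) v
    = B v ^+ 2 - v 0 j ^+ 2 * A v ^+ 2.
Proof.
rewrite /B /odd_contraction /A -!peval_contraction_poly /peval.
by rewrite mpoly.mevalB rmorphXn /= [X in _ - X]mpoly.mevalM !rmorphXn /= mpoly.mevalXU.
Qed.

Lemma genericity_polyP v : peval genericity_poly v != 0 ->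
  [/\ forall j, v 0 j != 0, injective (fun j => v 0 j ^+ 2)
    & forall j, B v ^+ 2 - v 0 j ^+ 2 * A v ^+ 2 != 0].
Proof.
rewrite /peval !mpoly.mevalM !mulf_eq0 !negb_or -!/(peval _ _) !peval_prod.
move=> /andP[/andP[/prodf_neq0 v0 /prodf_neq0 vv] /prodf_neq0 ex].
split=> [j|j k jk|j].
- by have := v0 j isT; rewrite /peval mpoly.mevalXU.
- apply/eqP; apply: contraTT isT => njk; have := vv (j, k) njk.
  by rewrite /peval rmorphB !rmorphXn /= !mpoly.mevalXU jk subrr eqxx.
by have := ex j isT; rewrite peval_extra.
Qed.

Lemma dense_generic : (exists2 k, (k <= n.*2.+1)%N & e k != 0) ->
  dense [set v | peval genericity_poly v != 0]%classic.
Proof.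
move=> e0.
apply: dense_nonvanishingM; first apply: dense_nonvanishingM; apply: dense_nonvanishing_prod.
- move=> j _; exists (const_mx 1).
  by rewrite /peval mpoly.mevalXU mxE oner_eq0.
- move=> [j k] /= jk; exists (delta_mx 0 j).
  rewrite /peval rmorphB !rmorphXn /= !mpoly.mevalXU !mxE !eqxx [k == j]eq_sym (negPf jk).
  by rewrite expr1n expr0n subr0 oner_eq0.
(* the nonzero of the univariate polynomial is taken positive in order to be the
   square of a point of the diagonal *)
move=> j _; have [p p0 pE] := contractions_nondegenerate e0.
have [t [t0 _ pt]] := exists_small_nonroot p0 ltr01.
exists (const_mx (Num.sqrt t)); rewrite peval_extra /A /B mxE.
have := pE (Num.sqrt t); rewrite sqr_sqrtr ?ltW //.
have -> : (const_mx (Num.sqrt t) : 'rV_n) 0 = (fun=> Num.sqrt t).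
  by apply: funext => i; rewrite mxE.
by move=> <-.
Qed.

End GenericNodes.

(** * The decomposition *)

Theorem theorem2p1 (R : realType) (nu d : nat) (hd : d = (2 * nu + 1)%N)
    (hd1 : (1 < d)%N) (c : 'rV[R]_d.+1) (hc : c != 0) :
  exists (G : set 'rV[R]_nu) (R1 R2 : 'rV[R]_nu -> R),
    [/\ open G, dense G, semialgebraic G, rational_on G R1 /\ rational_on G R2
      & forall s : 'rV[R]_nu, G s ->
        (* lam k is the coefficient of index k of the decomposition,
           for 1 <= k <= d; the component s_j, 1 <= j <= nu, is s 0 (j - 1) *)
        exists lam : nat -> R,
          waring_decomposition d (binary_form c)
            ([seq (lam (2 * j + 1)%N, x_ + s 0 j *: y_) | j : 'I_nu <- enum 'I_nu]
             ++ [seq (lam (2 * j + 2)%N, x_ - s 0 j *: y_) | j : 'I_nu <- enum 'I_nu]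
             ++ [:: (lam d, R1 s *: x_ + R2 s *: y_)])].
Proof.
have d_odd : d = nu.*2.+1 by lia.
(* [c] is indexed by the exponent of [x], and [e] by that of [y] *)
pose e k := c 0 (inord (d - k)).
have e_neq0 : exists2 k, (k <= nu.*2.+1)%N & e k != 0.
  have [i ci] : exists i, c 0 i != 0 by apply/rV0Pn.
  exists (d - i)%N; first by rewrite -d_odd leq_subr.
  by rewrite /e subKn ?inord_val // -ltnS.
have rational f : rational_on [set v | peval (genericity_poly nu e) v != 0]%classic
    (fun v => even_contraction (v 0) f).
  exists (contraction_poly nu f), 1 => v _.
  by rewrite peval_contraction_poly /peval mpoly.meval1 oner_eq0 divr1.
exists [set v | peval (genericity_poly nu e) v != 0]%classic.
exists (fun v => even_contraction (v 0) e), (fun v => odd_contraction (v 0) e).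
split; first exact: open_nonvanishing.
- exact: dense_generic.
- exact: semialgebraic_nonvanishing.
- by split; exact: rational.
move=> s /genericity_polyP[s0 s_inj extra].
have [p [m [l eE]]] := symmetric_power_sums_with_extra s0 s_inj extra.
have [lam [lamp lamm laml]] := interleave p m l.
rewrite -hd in laml; exists lam.
set A := even_contraction _ _ in extra eE *; set B := odd_contraction _ _ in extra eE *.
have -> : [seq (lam (2 * j + 1)%N, x_ + s 0 j *: y_) | j : 'I_nu <- enum 'I_nu]
      ++ [seq (lam (2 * j + 2)%N, x_ - s 0 j *: y_) | j : 'I_nu <- enum 'I_nu]
      ++ [:: (lam d, A *: x_ + B *: y_)]
    = [seq (t.1, t.2.1 *: x_ + t.2.2 *: y_) |
        t <- [seq (p j, (1, s 0 j)) | j <- enum 'I_nu]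
             ++ [seq (m j, (1, - s 0 j)) | j <- enum 'I_nu] ++ [:: (l, (A, B))]].
  rewrite !map_cat -!map_comp /= laml; congr (_ ++ (_ ++ _)); apply: eq_map => j /=.
    by rewrite lamp scale1r.
  by rewrite lamm scale1r scaleNr.
apply: waring_decomposition_of_coefs => [i|].
  have id : (i <= d)%N by rewrite -ltnS.
  have := eE (d - i)%N; rewrite /e subKn // inord_val -d_odd leq_subr => -> //.
  rewrite !big_cat !big_map big_seq1 /= addrA subKn //.
  by congr (_ + _ + _); rewrite -enumT big_enum; apply: eq_bigr => j _; rewrite expr1n mul1r.
have s_inj1 : injective (s 0) by move=> j k sjk; apply: s_inj; rewrite /= sjk.
have sN j k : s 0 j != - s 0 k.
  apply/eqP => sjk; have jk : j = k by apply: s_inj; rewrite /= sjk sqrrN.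
  by move/eqP: sjk; rewrite jk -addr_eq0 -mulr2n mulrn_eq0 (negPf (s0 k)).
have sAB j : (B != s 0 j * A) && (B != - s 0 j * A).
  have := extra j; rewrite -exprMn subr_sqr mulf_eq0 negb_or subr_eq0 addr_eq0.
  by rewrite mulNr.
have inj_enum (sg : 'I_nu -> R * (R * R)) :
    (forall j k, j != k -> (sg j).2.1 * (sg k).2.2 != (sg k).2.1 * (sg j).2.2) ->
    pairwise (fun t t' => t.2.1 * t'.2.2 != t'.2.1 * t.2.2) [seq sg j | j <- enum 'I_nu].
  move=> sg_neq; rewrite pairwise_map.
  apply: (sub_pairwise (r := [rel j k | j != k])) => [j k /sg_neq //|].
  by rewrite -uniq_pairwise enum_uniq.
have extra_last (sg : 'I_nu -> R * (R * R)) :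
    (forall j, B * (sg j).2.1 != (sg j).2.2 * A) ->
    allrel (fun t t' => t.2.1 * t'.2.2 != t'.2.1 * t.2.2)
      [seq sg j | j <- enum 'I_nu] [:: (l, (A, B))].
  move=> sgAB; rewrite allrel1r all_map; apply/allP => j _ /=.
  by rewrite mulrC [A * _]mulrC sgAB.
rewrite !pairwise_cat allrel_catr; apply/and3P; split.
- apply/andP; split; last by apply: extra_last => j; rewrite mulr1; case/andP: (sAB j).
  rewrite allrel_mapl allrel_mapr; apply/allrelP => j k _ _ /=.
  by rewrite !mul1r eq_sym.
- by apply: inj_enum => j k jk /=; rewrite !mul1r eq_sym (inj_eq s_inj1).
apply/and3P; split=> //.
  by apply: extra_last => j; rewrite mulr1; case/andP: (sAB j).
by apply: inj_enum => j k jk /=; rewrite !mul1r eqr_opp eq_sym (inj_eq s_inj1).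
Qed.
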